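(* Let $p,q\geq 5$ be distinct primes, let $n,m\in\mathbb{N}=\{0,1,2,\dots\}$, and let $G = C_{p^nq^m}$ be the cyclic group of order $p^nq^m$. Then every saturated $G$-transfer system $\mathcal{T}$ is realized by a linear isometries operad: there exists a $G$-universe $\mathcal{U}$ such that the $G$-transfer system $\underline{\mathcal{C}}(\mathcal{L}(\mathcal{U}))$ associated with the linear isometries operad $\mathcal{L}(\mathcal{U})$ equals $\mathcal{T}$.
   Context: Let $G$ be a finite group. **Transfer systems.** A $G$-transfer system is a relation $\to$ on the set of subgroups of $G$ refining inclusion (i.e. $K\to H$ implies $K\leq H$) that is reflexive ($H\to H$ for all $H\le G$), transitive, closed under conjugation ($K\to H$ implies $gKg^{-1}\to gHg^{-1}$ for all $g\in G$), and closed under restriction ($K\to H$ and $M\leq H$ imply $K\cap M\to M$). It is saturated if whenever $K\to H$ and $K\leq N\leq H$, both $K\to N$ and $N\to H$. **Universes.** A $G$-universe $\mathcal{U}$ is a real inner product space of countably infinite dimension with an action of $G$ by linear isometries, such that any sub-representation occurs infinitely often and the trivial one-dimensional representation occurs. Equivalently, $\mathcal{U}\cong\bigoplus_{\mathbb{N}}(\mathbb{R}_{\mathrm{triv}}\oplus V_1\oplus\dots\oplus V_k)$ for some finite-dimensional (irreducible) real isometric representations $V_1,\dots,V_k$ of $G$. **Linear isometries operad.** $\mathcal{L}(\mathcal{U})$ is the operad whose arity-$r$ operations $\mathcal{L}(\mathcal{U})(r)$ are the (not necessarily equivariant, not necessarily surjective) linear isometries $f:\mathcal{U}^{\oplus r}\to\mathcal{U}$,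 with operad structure as in the endomorphism operad, $G$ acting by $(g\cdot f)(x_1,\dots,x_r)=g\cdot f(g^{-1}x_1,\dots,g^{-1}x_r)$ and the symmetric group $S_r$ acting on the left by $(\sigma\cdot f)(x_1,\dots,x_r)=f(x_{\sigma(1)},\dots,x_{\sigma(r)})$. These actions commute, so $G\times S_r$ acts on $\mathcal{L}(\mathcal{U})(r)$. **Associated transfer system.** For $K\leq H\leq G$, let $r=[H:K]$, enumerate $H/K=\{t_1,\dots,t_r\}$, and for $h\in H$ let $\sigma_h\in S_r$ be defined by $h\cdot t_i=t_{\sigma_h(i)}$. Let $\Gamma_{H,K}=\{(h,\sigma_h): h\in H\}\leq G\times S_r$. The transfer system $\underline{\mathcal{C}}(\mathcal{L}(\mathcal{U}))$ is defined by: $K\to H$ if and only if $K\le H$ and $\mathcal{L}(\mathcal{U})(r)^{\Gamma_{H,K}}\neq\emptyset$ (this does not depend on the enumeration). *)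

(* Defs.v *)
From HB Require Import structures.
From mathcomp Require Import all_boot all_order all_fingroup all_algebra.
From mathcomp Require Import cyclic sesquilinear reals.

Set Implicit Arguments.
Unset Strict Implicit.
Unset Printing Implicit Defensive.

Import Order.TTheory GRing.Theory Num.Theory.
Local Open Scope group_scope.
Local Open Scope ring_scope.

(* Throughout, the ambient finite group is the whole type gT, so that its
   subgroups are exactly the elements of {group gT}. *)

Section TransferSystems.
Variable gT : finGroupType.
Implicit Types (K H M N : {group gT}) (T : {group gT} -> {group gT} -> Prop).

(* K :^ g^-1 is g K g^-1, since K :^ x is x^-1 K x. *)
Definition transfer_system T : Prop :=
  [/\ forall K H, T K H -> K \subset H,
      forall H, T H H,
      forall K H M, T K H -> T H M -> T K M,
      forall K H g, T K H -> T (K :^ g^-1)%G (H :^ g^-1)%G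
    & forall K H M, T K H -> M \subset H -> T (K :&: M)%G M].

Definition saturated T : Prop :=
  forall K H N, T K H -> K \subset N -> N \subset H -> T K N /\ T N H.

End TransferSystems.

Section Universes.
Variables (R : realType) (gT : finGroupType).

Record isomRep := IsomRep {
  carrier :> lmodType R;
  dot : {dot carrier for idfun};
  act : gT -> {linear carrier -> carrier};
  act1 : forall x, act 1%g x = x;
  actM : forall g h x, act (g * h)%g x = act g (act h x);
  act_isom : forall g, isometry dot dot (act g)
}.

#[local] Arguments act {i}.
Variable U : isomRep.

(* The dimension is the algebraic one: a Hamel basis indexed by nat. *)
Definition countably_infinite_dim : Prop :=
  exists e : nat -> U,
    (forall n (c : 'I_n -> R), \sum_(i < n) c i *: e i = 0 -> forall i, c i = 0)
    /\ (forall x : U, exists n, exists c : 'I_n -> R,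
          x = \sum_(i < n) c i *: e i).

Definition subrep (W : {pred U}) : Prop :=
  submod_closed W /\ forall g, {in W, forall x, act g x \in W}.

(* The orthogonal direct sum of countably many copies of W embeds
   isometrically and equivariantly: phi k is the k-th copy. *)
Definition occurs_infinitely_often (W : {pred U}) : Prop :=
  exists phi : nat -> U -> U,
    [/\ forall k a, {in W &, forall x y,
          phi k (a *: x + y) = a *: phi k x + phi k y},
        forall k g, {in W, forall x, phi k (act g x) = act g (phi k x)}
      & forall k l, {in W &, forall x y,
          dot U (phi k x) (phi l y) = if k == l then dot U x y else 0}].

Definition trivial_occurs : Prop :=
  exists2 v : U, v != 0 & forall g, act g v = v.

Definition universe : Prop :=
  [/\ countably_infinite_dim,
      forall W, subrep W -> occurs_infinitely_often W
    & trivial_occurs].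

End Universes.
Arguments act {R gT i}.

Section LinearIsometries.
Variables (R : realType) (gT : finGroupType) (U : isomRep R gT) (r : nat).

Definition dsum_dot (x y : {ffun 'I_r -> U}) : R := \sum_(i < r) dot U (x i) (y i).

Fact dsum_dot_bilinear :
  bilinear_for (GRing.Scale.Law.clone _ _ *%R _)
               (GRing.Scale.Law.clone _ _ (idfun \; *%R) _) dsum_dot.
Proof.
split=> [y | x] a u v; rewrite /dsum_dot /= mulr_sumr -big_split;
  apply: eq_bigr => i _ /=; rewrite !ffunE.
  by rewrite linearPl.
by rewrite linearPr.
Qed.

HB.instance Definition _ :=
  bilinear_isBilinear.Build R _ _ _ _ _ dsum_dot dsum_dot_bilinear.

Fact dsum_dot_sym : forall x y, dsum_dot x y = (-1) ^+ false * idfun (dsum_dot y x).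
Proof.
move=> x y; rewrite expr0 mul1r; apply: eq_bigr => i _.
by rewrite hermitian_subproof expr0 mul1r.
Qed.

HB.instance Definition _ :=
  isHermitianSesquilinear.Build R _ false idfun dsum_dot dsum_dot_sym.

Fact dsum_dot_gt0 : forall x, x != 0 -> 0 < dsum_dot x x.
Proof.
have dot_ge0 (v : U) : 0 <= dot U v v.
  have [->|vN0] := eqVneq v 0; first by rewrite linear0l.
  exact/ltW/neq0_dnorm_gt0.
move=> x /eqP xN0; rewrite lt_neqAle sumr_ge0 // andbT eq_sym.
apply/eqP => x0; apply: xN0; apply/ffunP => i; rewrite ffunE.
apply/eqP/negPn/negP => /(@neq0_dnorm_gt0 _ _ idfun (dot U)).
by rewrite (psumr_eq0P _ x0) ?ltxx.
Qed.

HB.instance Definition _ := isDotProduct.Build R _ dsum_dot dsum_dot_gt0.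

(* The arity-r operations of the linear isometries operad L(U). Only these
   sets and their actions of G x S_r, not the operadic composition, enter the
   definition of the associated transfer system. *)
Record linIsom := LinIsom {
  lin_fun :> {linear {ffun 'I_r -> U} -> U};
  lin_funP : isometry (dot U) dsum_dot lin_fun
}.

Definition linIsom_act_fun (g : gT) (s : 'S_r) (f : linIsom)
    (x : {ffun 'I_r -> U}) : U :=
  act g (f [ffun i => act g^-1%g (x (s i))]).

Fact linIsom_act_linear g s f : linear (linIsom_act_fun g s f).
Proof.
move=> a x y; rewrite /linIsom_act_fun -linearP -linearP; congr (act g (f _)).
by apply/ffunP => i; rewrite !ffunE linearP.
Qed.

HB.instance Definition _ g s f :=
  GRing.isLinear.Build R _ _ _ (linIsom_act_fun g s f) (linIsom_act_linear g s f).

Fact linIsom_act_isom g s f : isometry (dot U) dsum_dot (linIsom_act_fun g s f).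
Proof.
move=> x y; rewrite /linIsom_act_fun act_isom lin_funP /dsum_dot.
rewrite [RHS](reindex_inj (@perm_inj _ s)).
by apply: eq_bigr => i _; rewrite !ffunE act_isom.
Qed.

(* The action of (g, s) in G x S_r on L(U)(r). It is a left action when S_r
   carries composition of functions; the product s * t of 'S_r is the opposite
   one, (s * t) i = t (s i). *)
Definition linIsom_act g s f : linIsom := LinIsom (linIsom_act_isom g s f).

Fact linIsom_actM g h s t f :
  linIsom_act (g * h)%g (t * s)%g f =1 linIsom_act g s (linIsom_act h t f).
Proof.
move=> x /=; rewrite /linIsom_act_fun /= /linIsom_act_fun actM.
congr (act g (act h (f _))).
by apply/ffunP => i; rewrite !ffunE permM invMg actM.
Qed.

Definition linIsom_fixed (A : {set gT * 'S_r}) (f : linIsom) : Prop :=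
  forall gs, gs \in A -> linIsom_act gs.1 gs.2 f =1 f.

End LinearIsometries.

Section AssociatedTransferSystem.
Variable gT : finGroupType.
Implicit Types K H : {group gT}.

Definition coset_at K H (i : 'I_#|H : K|) : {set gT} :=
  enum_val (cast_ord (esym (card_lcosets H K)) i).
Arguments coset_at : clear implicits.

(* Gamma K H is the graph of h |-> sigma_h on H: see Gamma_graph. *)
Definition Gamma K H : {set gT * 'S_#|H : K|} :=
  [set hs : gT * 'S_#|H : K| | (hs.1 \in H) &&
     [forall i, (hs.1 *: coset_at K H i)%g == coset_at K H (hs.2 i)]].

Fact coset_at_inj K H : injective (coset_at K H).
Proof. by move=> i j /enum_val_inj/cast_ord_inj. Qed.

Fact coset_atP K H (C : {set gT}) :
  reflect (exists i, C = coset_at K H i) (C \in lcosets K H).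
Proof.
apply: (iffP idP) => [HC | [i ->]]; last exact: enum_valP.
exists (cast_ord (card_lcosets H K) (enum_rank_in HC C)).
by rewrite /coset_at cast_ordK enum_rankK_in.
Qed.

Fact Gamma_graph K H h : h \in H -> exists! s, (h, s) \in Gamma K H.
Proof.
move=> Hh; have /fin_all_exists[f fP] i : exists j,
    (h *: coset_at K H i)%g = coset_at K H j.
  apply/coset_atP; have /lcosetsP[x Hx ->]: coset_at K H i \in lcosets K H.
    by apply/coset_atP; exists i.
  by apply/lcosetsP; exists (h * x)%g; rewrite ?groupM ?lcosetM.
have f_inj : injective f.
  by move=> i j fij; apply/coset_at_inj/(@lcoset_inj _ h); rewrite !fP fij.
exists (perm f_inj); split=> [|s].
  by rewrite inE Hh; apply/forallP => i; rewrite permE fP.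
rewrite inE => /andP[_ /forallP sP]; apply/permP => i.
by apply: coset_at_inj; rewrite permE -fP; apply/eqP/sP.
Qed.

Definition assoc_transfer (R : realType) (U : isomRep R gT) K H : Prop :=
  K \subset H /\ exists f : linIsom U #|H : K|, linIsom_fixed (Gamma K H) f.

End AssociatedTransferSystem.

(* Main.v *)
(* A universe of a cyclic group of order p^n q^m is given by a symmetric set I
   of integers containing 0: it is the sum of infinitely many copies of the
   complex lines on which G acts through the characters w^x, x in I.  Restricted
   to a subgroup of order e only I mod e matters, and inducing from order d to
   order e multiplies by the characters w^(td).  Hence K -> H holds for the
   linear isometries operad iff I mod |H| is stable under translation by |K|,
   i.e. is the full preimage of I mod |K|.

   This relation and T are both determined by the covering pairs K < H (of prime
   index), which form a grid.  Take for I the integers x such that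
   - x is not +-2p^i mod p^(i+1), when the p-edge i at q-level 0 is missing in T;
   - x is not +-2q^j mod q^(j+1), when the q-edge j at p-level 0 is missing in T;
   - x is not simultaneously +-p^i mod p^(i+1) and +-q^j mod q^(j+1), when both
     the top and the right edge of the square (i, j) are missing in T.
   Only the leading p-adic and q-adic digits of x matter, so a residue extends
   to an element of I by lifting 0 to 0 and anything else arbitrarily.  A missing
   edge is witnessed by one of the forbidden residues, thanks to the
   three-out-of-four property of the squares of a saturated transfer system; the
   digits 0, +-1, +-2 have to be distinct, whence p, q >= 5. *)
Require Import Defs.
From HB Require Import structures.
From mathcomp Require Import all_boot all_order all_fingroup all_algebra.
From mathcomp Require Import cyclic separable cyclotomic boolp reals complex.
From mathcomp Require Import ring zify.

Set Implicit Arguments.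
Unset Strict Implicit.
Unset Printing Implicit Defensive.

Import Order.TTheory GRing.Theory Num.Theory.
Local Open Scope ring_scope.

(** * Sets of integers stable under translation *)

Definition full_preimage (I : int -> Prop) (d e : nat) : Prop :=
  forall x t : int, I x -> exists2 y, I y & (e %| y - (x + t * d))%Z.

Lemma full_preimage_trans I d f e :
  full_preimage I d f -> full_preimage I f e -> full_preimage I d e.
Proof.
move=> df fe x t Ix; have [y Iy /dvdzP[s ys]] := df x t Ix.
(* [y] misses [x + t * d] by [s * f]; translating it by [- s * f] modulo [e] corrects this. *)
have [z Iz zy] := fe y (- s) Iy; exists z => //.
have -> : z - (x + t * d) = z - (y + - s * f)
  by rewrite -[y](subrK (x + t * d)) ys; ring.
by [].
Qed.

Lemma full_preimage_between I d f e : (d %| f)%N -> (f %| e)%N ->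
  full_preimage I d e -> full_preimage I d f /\ full_preimage I f e.
Proof.
move=> /dvdnP[k ->] fe de; split=> x t Ix.
  have fez : ((k * d)%N%:Z %| e%:Z)%Z by [].
  by have [y Iy /(dvdz_trans fez)] := de x t Ix; exists y.
have [y Iy] := de x (t * k) Ix; exists y => //.
by rewrite PoszM mulrA.
Qed.

(** For [s] prime to [p]: the first nonzero p-adic digit of [x] is in position [i] and is [s] or
    [-s] modulo [p]. *)
Definition lead (s p i : nat) (x : int) : bool :=
  (p%:Z ^+ i.+1 %| x - s%:Z * p%:Z ^+ i)%Z || (p%:Z ^+ i.+1 %| x + s%:Z * p%:Z ^+ i)%Z.

Section Lead.
Variable p : nat.
Hypothesis p_gt4 : (4 < p)%N.

Let pX0 i : p%:Z ^+ i != 0.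
Proof. by rewrite expf_neq0 //; lia. Qed.

Lemma lead_congr s i j x y : (i < j)%N -> (p%:Z ^+ j %| x - y)%Z ->
  lead s p i x = lead s p i y.
Proof.
move=> ij /(dvdz_trans (dvdz_exp2l p ij)) xy.
have E z : (p%:Z ^+ i.+1 %| x + z)%Z = (p%:Z ^+ i.+1 %| y + z)%Z.
  by rewrite -[x](subrK y) -addrA rpredDl.
by rewrite /lead !E.
Qed.

Lemma leadN s i x : lead s p i (- x) = lead s p i x.
Proof.
rewrite /lead orbC -[X in X || _]rpredN -[X in _ || X]rpredN.
by rewrite !opprD !opprK.
Qed.

Lemma lead_dvd s i x : lead s p i x -> (p%:Z ^+ i %| x)%Z.
Proof.
by case/orP=> /(dvdz_trans (dvdz_exp2l p (leqnSn i)));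
  rewrite ?rpredBr ?rpredDr // dvdz_mull.
Qed.

Lemma lead0 s i : (0 < s < 3)%N -> lead s p i 0 = false.
Proof.
move=> s_range; rewrite /lead sub0r add0r rpredN orbb exprS dvdz_mul2r //.
by rewrite dvdzE /= gtnNdvd; lia.
Qed.

Lemma lead_expn s i j : (0 < s < 3)%N ->
  lead s p i (p%:Z ^+ j) = (s == 1)%N && (i == j).
Proof.
move=> s_range; have [->|ij] := eqVneq i j.
  rewrite andbT /lead -{1 3}[p%:Z ^+ j]mul1r -mulrBl -mulrDl exprS !dvdz_mul2r //.
  case: s s_range => [|[|[|]]] // _.
    by rewrite subrr dvdz0.
  (* Here [s = 2], and [p > 4] divides neither [1 - 2] nor [1 + 2]. *)
  by apply/negP => /orP[]; rewrite dvdzE => /dvdn_leq; lia.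
rewrite andbF; case: (ltnP i j) => [lij|lji].
  by rewrite (@lead_congr s i i.+1 _ 0) ?lead0 // subr0 dvdz_exp2l.
apply/negP => /lead_dvd; rewrite dvdz_Pexp2l; last by lia.
by rewrite leqNgt ltn_neqAle eq_sym ij lji.
Qed.

Definition zero_lift i x : int := if (p%:Z ^+ i %| x)%Z then 0 else x.

Lemma zero_lift_congr i x : (p%:Z ^+ i %| zero_lift i x - x)%Z.
Proof. by rewrite /zero_lift; case: ifP => [|_]; rewrite ?sub0r ?rpredN // subrr dvdz0. Qed.

(** Zero has no leading digit, and an [x] not divisible by [p ^ i] has its leading digit below
    position [i]. So this lift creates no forbidden digit that [x] did not have. *)
Lemma lead_zero_lift s i k x : (0 < s < 3)%N -> lead s p k (zero_lift i x) ->
  (k < i)%N /\ lead s p k x.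
Proof.
move=> s_range; rewrite /zero_lift; case: ifP => [_|/negP xi]; first by rewrite lead0.
move=> kx; split=> //; rewrite ltnNge; apply/negP => ik; apply: xi.
exact: dvdz_trans (dvdz_exp2l p ik) (lead_dvd kx).
Qed.
End Lead.

(* [h i j] stands for the edge p^i q^j -> p^(i+1) q^j, and [v j i] for the edge
   p^i q^j -> p^i q^(j+1): exchanging (p, n, h) and (q, m, v) reflects the grid. *)
Definition admissible p n (h : nat -> nat -> Prop) q m (v : nat -> nat -> Prop)
    (a b : int) :=
  [/\ forall i, (i < n)%N -> ~ h i 0%N -> ~ lead 2 p i a,
      forall j, (j < m)%N -> ~ v j 0%N -> ~ lead 2 q j b
    & forall i j, (i < n)%N -> (j < m)%N -> ~ h i j.+1 -> ~ v j i.+1 ->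
        ~ (lead 1 p i a /\ lead 1 q j b)].

Lemma admissibleC p n h q m v a b :
  admissible p n h q m v a b -> admissible q m v p n h b a.
Proof.
case=> ha vb hv; split=> // j i jm im vj hi [b1 a1].
by apply: (hv i j).
Qed.

Definition restricts n (h : nat -> nat -> Prop) m :=
  forall i j, (i < n)%N -> (j < m)%N -> h i j.+1 -> h i j.

Definition fills n (h : nat -> nat -> Prop) m (v : nat -> nat -> Prop) :=
  forall i j, (i < n)%N -> (j < m)%N -> h i j -> v j i.+1 -> h i j.+1.

Section Edge.
Variables (p n : nat) (h : nat -> nat -> Prop) (q m : nat) (v : nat -> nat -> Prop).
Hypotheses (p_gt4 : (4 < p)%N) (q_gt4 : (4 < q)%N).
Hypotheses (hR : restricts n h m) (hvF : fills n h m v).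

(** The integer [x] is replaced by a pair: [a] stands for it modulo powers of [p], and [b] modulo
    powers of [q]. The Chinese remainder theorem makes the two independent. *)
Definition full_edge i j := forall a b t, admissible p n h q m v a b ->
  exists a' b', [/\ admissible p n h q m v a' b',
    (p%:Z ^+ i.+1 %| a' - (a + t * p%:Z ^+ i))%Z & (q%:Z ^+ j %| b' - b)%Z].

Lemma restrictsW i j k : (i < n)%N -> (j <= m)%N -> (k <= j)%N -> h i j -> h i k.
Proof.
move=> lin; elim: j => [|j IHj] ltjm; first by rewrite leqn0 => /eqP->.
rewrite leq_eqVlt => /predU1P[-> //|kj] /hR hij.
by apply: IHj (hij _ _) => //; apply: ltnW.
Qed.

Lemma full_edgeP i j : (i < n)%N -> (j <= m)%N -> full_edge i j <-> h i j.
Proof.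
move=> lin ljm; split; last first.
  (* The zero lifts of [a0] and [b] could only violate a condition on the p-digit in position [i].
     The lift of [b] has no digit from position [j] on, and [h i j] restricts to all q-levels below
     [j], so no such condition applies. *)
  move=> hij a b t [ha vb hv]; pose a0 := a + t * p%:Z ^+ i.
  have a0P s k : (k < i)%N -> lead s p k a0 = lead s p k a.
    by move=> ki; apply: (lead_congr _ ki); rewrite addrAC subrr add0r dvdz_mull.
  exists (zero_lift p i.+1 a0), (zero_lift q j b); split; last 2 first.
  - exact: zero_lift_congr.
  - exact: zero_lift_congr.
  split=> [k lkn hk /lead_zero_lift[]// ki|k lkm vk /lead_zero_lift[]// kj|k l lkn llm hkl vlk].
  - move: ki; rewrite ltnS leq_eqVlt => /predU1P[ki|ki].
      by case: hk; rewrite ki; apply: restrictsW hij.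
    by rewrite a0P //; apply: ha.
  - exact: vb.
  - case=> /lead_zero_lift[]// ki a0k /lead_zero_lift[]// lj bl.
    move: ki; rewrite ltnS leq_eqVlt => /predU1P[ki|ki].
      by case: hkl; rewrite ki; apply: restrictsW hij.
    by apply: (hv k l) => //; rewrite -a0P.
elim: j ljm => [|j IHj] ljm full.
  apply: contrapT => hi0.
  (* Translating 0 by [2 * p ^ i] gives the residue forbidden by the missing edge [h i 0]. *)
  have [|a' [b' [[ha' _ _] a'P _]]] := full 0 0 2.
    by split=> [? _ _|? _ _|? ? _ _ _ _ []]; rewrite lead0.
  by apply: (ha' i) => //; rewrite (lead_congr _ (ltnSn i) a'P) /lead add0r subrr dvdz0.
(* If the right edge of the square is present, induction gives the bottom edge, and the two force
   the top one. *)
apply: contrapT => hij; case: (pselect (v j i.+1)) => vji.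
  apply: hij; apply: hvF (vji) => //; apply: IHj (ltnW ljm) _ => a b t.
  move=> /(full a b t)[a' [b' [? ? b'P]]].
  by exists a', b'; split=> //; apply: dvdz_trans b'P; apply: dvdz_exp2l.
(* Top and right edges are both missing. The pair [(0, q ^ j)] is admissible because the digit 1
   differs from 2 and -2, but its translate [(p ^ i, q ^ j)] is forbidden. *)
have [|a' [b' [[_ _ hv] a'P b'P]]] := full 0 (q%:Z ^+ j) 1.
  split=> [? _ _|? _ _|? ? _ _ _ _ []]; rewrite ?lead0 //.
  by rewrite lead_expn.
apply: (hv i j) => //.
by rewrite (lead_congr _ _ a'P) // (lead_congr _ _ b'P) // lead_expn ?eqxx //
  /lead add0r mul1r subrr dvdz0.
Qed.
End Edge.

Lemma admissible_congr p n h q m v a b a' b' :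
  (p%:Z ^+ n %| a' - a)%Z -> (q%:Z ^+ m %| b' - b)%Z ->
  admissible p n h q m v a b -> admissible p n h q m v a' b'.
Proof.
move=> aa bb [ha vb hv]; split=> [i lin|j ljm|i j lin ljm].
- by rewrite (lead_congr 2 lin aa); apply: ha.
- by rewrite (lead_congr 2 ljm bb); apply: vb.
by rewrite (lead_congr 1 lin aa) (lead_congr 1 ljm bb); apply: hv.
Qed.

Lemma crt (d e a b : int) : coprimez d e ->
  exists x : int, (d %| x - a)%Z /\ (e %| x - b)%Z.
Proof.
move=> co; exists (zchinese d e a b); split; rewrite -eqz_mod_dvd; apply/eqP.
  exact: zchinese_modl.
exact: zchinese_modr.
Qed.

Section Saturates.
Variables (p n : nat) (h : nat -> nat -> Prop) (q m : nat) (v : nat -> nat -> Prop).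
Hypothesis co_pq : coprimez p q.
Let I x := admissible p n h q m v x x.

Lemma full_preimage_edge i j : (i < n)%N -> (j <= m)%N ->
  full_preimage I (p ^ i * q ^ j) (p ^ i.+1 * q ^ j) <-> full_edge p n h q m v i j.
Proof.
have co k l : coprimez (p%:Z ^+ k) (q%:Z ^+ l) by rewrite coprimezXl ?coprimezXr.
have expE k l : (p ^ k * q ^ l)%N = p%:Z ^+ k * q%:Z ^+ l :> int.
  by rewrite PoszM -!natz !natrX !natz.
move=> lin ljm; rewrite /full_preimage !expE; split=> [sat a b t Jab|full x t Ix].
  have [x [xa xb]] := crt a b (co n m).
  (* With [t' * q ^ j] congruent to [t] modulo [p], translation by [t' * p ^ i * q ^ j] moves [a] by
     [t * p ^ i] modulo [p ^ i.+1] and fixes [b] modulo [q ^ j]. *)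
  have [s [/dvdzP[t' ->] st]] : exists s : int, (q%:Z ^+ j %| s)%Z /\ (p %| s - t)%Z.
    have [|s [s0 st]] := @crt (q%:Z ^+ j) p 0 t.
      by rewrite coprimez_sym coprimezXr.
    by exists s; rewrite -[s in X in X /\ _]subr0.
  have Ix : I x by apply: admissible_congr Jab.
  have [y Iy yx] := sat x t' Ix; exists y, y; split=> //.
    have -> : y - (a + t * p%:Z ^+ i) = y - (x + t' * (p%:Z ^+ i * q%:Z ^+ j)) + (x - a)
        + (t' * q%:Z ^+ j - t) * p%:Z ^+ i by ring.
    apply: rpredD; last by rewrite exprS dvdz_mul.
    apply: rpredD; first by apply: dvdz_trans yx; rewrite dvdz_mulr.
    by apply: dvdz_trans xa; rewrite dvdz_exp2l.
  have -> : y - b = y - (x + t' * (p%:Z ^+ i * q%:Z ^+ j)) + (x - b)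
        + t' * p%:Z ^+ i * q%:Z ^+ j by ring.
  apply: rpredD; last by rewrite dvdz_mull.
  apply: rpredD; first by apply: dvdz_trans yx; rewrite dvdz_mull.
  by apply: dvdz_trans xb; rewrite dvdz_exp2l.
have [a [b [Jab ax bx]]] := full x x (t * q%:Z ^+ j) Ix.
have [y [ya yb]] := crt a b (co n m).
exists y; first exact: admissible_congr Jab.
rewrite Gauss_dvdz //; apply/andP; split.
  have -> : y - (x + t * (p%:Z ^+ i * q%:Z ^+ j)) =
      (y - a) + (a - (x + t * q%:Z ^+ j * p%:Z ^+ i)) by ring.
  by apply: rpredD => //; apply: dvdz_trans ya; rewrite dvdz_exp2l.
have -> : y - (x + t * (p%:Z ^+ i * q%:Z ^+ j)) =
    (y - b) + (b - x) - t * p%:Z ^+ i * q%:Z ^+ j by ring.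
apply: rpredB; last by rewrite dvdz_mull.
by apply: rpredD => //; apply: dvdz_trans yb; rewrite dvdz_exp2l.
Qed.
End Saturates.

Lemma full_preimage_realize p q n m (h v : nat -> nat -> Prop) :
  (4 < p)%N -> (4 < q)%N -> coprime p q ->
  restricts n h m -> restricts m v n -> fills n h m v -> fills m v n h ->
  exists I : int -> Prop, [/\ I 0, forall x, I x -> I (- x),
    forall i j, (i < n)%N -> (j <= m)%N ->
      full_preimage I (p ^ i * q ^ j) (p ^ i.+1 * q ^ j) <-> h i j
  & forall i j, (i <= n)%N -> (j < m)%N ->
      full_preimage I (p ^ i * q ^ j) (p ^ i * q ^ j.+1) <-> v j i].
Proof.
move=> p_gt4 q_gt4 co_pq hR vR hF vF.
exists (fun x => admissible p n h q m v x x).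
split=> [|x [xh xv xhv]|i j lin ljm|i j lin ljm].
- by split=> [i _ _|j _ _|i j _ _ _ _ []]; rewrite lead0.
- split=> [i|j|i j]; rewrite !leadN //; [exact: xh|exact: xv|exact: xhv].
- by rewrite full_preimage_edge // full_edgeP.
(* The q-edges are the p-edges of the reflected grid. *)
rewrite mulnC [(p ^ i * _)%N]mulnC -(full_edgeP q_gt4 p_gt4 vR vF) //.
have co_qp : coprimez q p by rewrite coprimez_sym.
apply: iff_trans (full_preimage_edge v h co_qp ljm lin).
by split=> sat x t /admissibleC/(sat x t)[y /admissibleC]; exists y.
Qed.

(** * Subgroups of a cyclic group *)

Section CyclicGroups.
Variables (gT : finGroupType).
Hypothesis cycG : cyclic [set: gT].
Implicit Types K H M N : {group gT}.

Lemma cyclic_card_inj K H : #|K| = #|H| -> K = H.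
Proof.
move=> eqKH; apply/val_inj/eqP.
by rewrite /= (eq_subG_cyclic cycG) ?subsetT // eqKH.
Qed.

Lemma cyclic_card_exists d : (d %| #|gT|)%N -> exists K, #|K| = d.
Proof.
move=> d_dvd; have [g gT_g] := cyclicP cycG.
have gE : #[g]%g = #|gT| by rewrite orderE -gT_g cardsT.
exists <[g ^+ (#|gT| %/ d)]>%G; rewrite /= -orderE orderXdiv gE ?dvdn_div //.
by rewrite divnA // mulKn // -cardsT cardG_gt0.
Qed.

Lemma cyclic_subG K H : (K \subset H) = (#|K| %| #|H|)%N.
Proof. by rewrite (cardSg_cyclic cycG) ?subsetT. Qed.

Lemma cyclic_cardI K H : #|(K :&: H)%G| = gcdn #|K| #|H|.
Proof.
have [|M cardM] := @cyclic_card_exists (gcdn #|K| #|H|).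
  by rewrite -cardsT (dvdn_trans (dvdn_gcdl _ _)) // cardSg ?subsetT.
apply/eqP; rewrite eqn_dvd dvdn_gcd !cardSg ?subsetIl ?subsetIr //= -cardM.
by rewrite cardSg // subsetI !cyclic_subG cardM dvdn_gcdl dvdn_gcdr.
Qed.

End CyclicGroups.

Lemma dvdn_expM p q n m d : prime p -> prime q -> (d %| p ^ n * q ^ m)%N ->
  exists i j, [/\ (i <= n)%N, (j <= m)%N & d = (p ^ i * q ^ j)%N].
Proof.
move=> p_pr q_pr; elim: n d => [|n IHn] d.
  rewrite expn0 mul1n => /(dvdn_pfactor _ _ q_pr)[j jm ->].
  by exists 0%N, j; rewrite mul1n.
case: (boolP (p %| d)%N) => [/dvdnP[e ->]|pd].
  rewrite expnS -mulnA mulnC dvdn_pmul2l ?prime_gt0 // => /IHn[i [j [lin ljm ->]]].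
  by exists i.+1, j; rewrite expnS mulnA.
rewrite expnS -mulnA Gauss_dvdr 1?coprime_sym ?prime_coprime //.
by move=> /IHn[i [j [lin ljm dE]]]; exists i, j; rewrite ltnW.
Qed.

(** * The grid of covering pairs of a saturated transfer system *)

Section Grid.
Variables (gT : finGroupType) (T : {group gT} -> {group gT} -> Prop).
Hypotheses (cycG : cyclic [set: gT]) (trT : transfer_system T) (satT : saturated T).
Implicit Types K H M N : {group gT}.

(** Any choice of [K] and [H] gives the same answer, since orders determine the subgroups of a
    cyclic group. The q-edges are given by [edge q p]. *)
Definition edge p q i j := exists K H,
  [/\ #|K| = (p ^ i * q ^ j)%N, #|H| = (p ^ i.+1 * q ^ j)%N & T K H].

Lemma edgeE p q i j K H : #|K| = (p ^ i * q ^ j)%N -> #|H| = (p ^ i.+1 * q ^ j)%N ->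
  edge p q i j <-> T K H.
Proof.
move=> oK oH; split=> [[K' [H' [oK' oH']]]|TKH]; last by exists K, H.
by rewrite (cyclic_card_inj cycG (etrans oK' (esym oK)))
  (cyclic_card_inj cycG (etrans oH' (esym oH))).
Qed.

Variables (p q n m : nat).
Hypotheses (p_pr : prime p) (q_pr : prime q) (co_pq : coprime p q).
Hypothesis oG : #|gT| = (p ^ n * q ^ m)%N.

(** Restrict to the subgroup [M] of order [p ^ i.+1 * q ^ j]: by coprimality it meets [K] in order
    [p ^ i * q ^ j]. *)
Lemma edge_restricts : restricts n (edge p q) m.
Proof.
move=> i j lin ljm [K [H [oK oH TKH]]].
have [|M oM] := @cyclic_card_exists _ cycG (p ^ i.+1 * q ^ j).
  by rewrite oG dvdn_mul // dvdn_exp2l // ltnW.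
have MH : M \subset H.
  by rewrite (cyclic_subG cycG) oM oH dvdn_mul // dvdn_exp2l.
have [_ _ _ _ /(_ _ _ M TKH MH)] := trT.
rewrite (edgeE (K := (K :&: M)%G) (H := M)) // cyclic_cardI // oK oM.
have -> : (p ^ i * q ^ j.+1 = p ^ i * q ^ j * q)%N by rewrite expnSr mulnA.
have -> : (p ^ i.+1 * q ^ j = p ^ i * q ^ j * p)%N by rewrite expnSr mulnAC.
by rewrite -muln_gcdr gcdnC (eqP co_pq) muln1.
Qed.

(** The bottom and right edges of a square compose to its diagonal. Saturation at the upper left
    corner [N] then yields the top edge. *)
Lemma edge_fills : fills n (edge p q) m (edge q p).
Proof.
move=> i j lin ljm [K [H [oK oH TKH]]] [H' [L [oH' oL TH'L]]].
have {oH'} HH' : H' = H by apply: (cyclic_card_inj cycG); rewrite oH oH' mulnC.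
subst H'.
have [_ _ /(_ _ _ _ TKH TH'L) TKL _ _] := trT.
have [|N oN] := @cyclic_card_exists _ cycG (p ^ i * q ^ j.+1).
  by rewrite oG dvdn_mul // dvdn_exp2l // ltnW.
have [||_ TNL] := satT (N := N) TKL.
- by rewrite (cyclic_subG cycG) oK oN dvdn_mul // dvdn_exp2l.
- by rewrite (cyclic_subG cycG) oN oL mulnC dvdn_mul // dvdn_exp2l.
by exists N, L; split=> //; rewrite oL mulnC.
Qed.
End Grid.

(** Both relations are transitive and pass to intermediate subgroups, so agreement on pairs of prime
    index suffices. The induction on the index inserts a subgroup [N] with [K] of prime index [r] in
    it; [r] is [p] or [q], and this decides the direction of the edge. *)
Lemma saturated_realize (gT : finGroupType) (T : {group gT} -> {group gT} -> Prop)
    (p q n m : nat) :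
  prime p -> prime q -> p != q -> (4 < p)%N -> (4 < q)%N ->
  cyclic [set: gT] -> #|gT| = (p ^ n * q ^ m)%N ->
  transfer_system T -> saturated T ->
  exists I : int -> Prop, [/\ I 0, forall x, I x -> I (- x) &
    forall K H : {group gT}, K \subset H -> full_preimage I #|K| #|H| <-> T K H].
Proof.
move=> p_pr q_pr neq_pq p_gt4 q_gt4 cycG oG trT satT.
have co_pq : coprime p q by rewrite prime_coprime // dvdn_prime2.
have co_qp : coprime q p by rewrite coprime_sym.
have oG' : #|gT| = (q ^ m * p ^ n)%N by rewrite mulnC.
have [I [I0 IN Ih Iv]] := full_preimage_realize p_gt4 q_gt4 co_pq
  (edge_restricts cycG trT co_pq oG) (edge_restricts cycG trT co_qp oG')
  (edge_fills cycG trT satT oG) (edge_fills cycG trT satT oG').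
exists I; split=> // K H; have [k] := ubnP #|H : K|%g; elim: k K => // k IHk K.
rewrite ltnS => leHK KH; have [TS TR TT _ _] := trT.
have [iHK1|iHK] := eqVneq #|H : K|%g 1%N.
  have -> : K = H by apply/val_inj/eqP; rewrite eqEsubset KH -indexg_eq1 iHK1 eqxx.
  by split=> // _ x t Ix; exists x => //; rewrite opprD addNKr rpredN dvdz_mull.
pose r := pdiv #|H : K|%g.
have r_pr : prime r by rewrite pdiv_prime // ltn_neqAle eq_sym iHK indexg_gt0.
have rK : (#|K| * r %| #|H|)%N.
  by rewrite -(Lagrange KH) dvdn_pmul2l ?cardG_gt0 // pdiv_dvd.
have HG : (#|H| %| p ^ n * q ^ m)%N by rewrite -oG -cardsT cardSg ?subsetT.
have rKG := dvdn_trans rK HG.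
have [|N oN] := @cyclic_card_exists _ cycG (#|K| * r); first by rewrite oG.
have KN : K \subset N by rewrite (cyclic_subG cycG) oN dvdn_mulr.
have NH : N \subset H by rewrite (cyclic_subG cycG) oN.
have TKN : full_preimage I #|K| #|N| <-> T K N.
  have [i [j [lin ljm oN']]] := dvdn_expM p_pr q_pr rKG.
  have : (r %| p ^ i * q ^ j)%N by rewrite -oN' dvdn_mull.
  rewrite Euclid_dvdM // !Euclid_dvdX // !dvdn_prime2 //.
  case/orP=> /andP[/eqP rE].
    case: i lin oN' => // i lin oN' _.
    have oK : #|K| = (p ^ i * q ^ j)%N.
      by apply/eqP; rewrite -(eqn_pmul2r (prime_gt0 r_pr)) oN' rE expnSr mulnAC.
    have oN2 := etrans oN oN'.
    by rewrite oN2 oK Ih //; apply: edgeE.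
  case: j ljm oN' => // j ljm oN' _.
  have oK : #|K| = (p ^ i * q ^ j)%N.
    by apply/eqP; rewrite -(eqn_pmul2r (prime_gt0 r_pr)) oN' rE expnSr mulnA.
  have oN2 := etrans oN oN'.
  by rewrite oN2 oK Iv //; apply: edgeE; rewrite // mulnC.
have TNH : full_preimage I #|N| #|H| <-> T N H.
  apply: IHk (NH); apply: leq_trans leHK.
  rewrite -(ltn_pmul2l (cardG_gt0 N)) (Lagrange NH) -(Lagrange KH).
  rewrite ltn_pmul2r ?indexg_gt0 //.
  by rewrite oN ltn_Pmulr // prime_gt1.
split=> [satKH|TKH].
  have [/TKN TKN' /TNH] := full_preimage_between (cardSg KN) (cardSg NH) satKH.
  exact: TT.
have [/TKN + /TNH] := satT _ _ _ TKH KN NH.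
exact: full_preimage_trans.
Qed.

(** * Polynomials as finitely supported sequences *)

Section Hermitian.
Variable C : numClosedFieldType.
Implicit Types (p q : {poly C}) (u v : nat -> {poly C}).

Definition herm p q : C := \sum_(k < size p) p`_k * (q`_k)^*.

Lemma herm_widen n p q : (size p <= n)%N -> herm p q = \sum_(k < n) p`_k * (q`_k)^*.
Proof.
move=> pn; rewrite /herm (big_ord_widen n (fun k => p`_k * (q`_k)^*)) // big_mkcond.
apply: eq_bigr => k _; case: ltnP => // pk; by rewrite nth_default ?mul0r.
Qed.

Lemma herm_linearl a p p' q : herm (a *: p + p') q = a * herm p q + herm p' q.
Proof.
pose n := maxn (maxn (size p) (size p')) (size (a *: p + p')).
rewrite !(herm_widen (n := n)) ?leq_max ?leqnn ?orbT // mulr_sumr -big_split.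
by apply: eq_bigr => k _; rewrite coefD coefZ mulrDl mulrA.
Qed.

Lemma herm_conjC p q : herm q p = (herm p q)^*.
Proof.
pose n := maxn (size p) (size q).
rewrite !(herm_widen (n := n)) ?leq_max ?leqnn ?orbT // rmorph_sum.
by apply: eq_bigr => k _; rewrite rmorphM /= conjCK mulrC.
Qed.

(** The arguments are swapped so that linearity in the first argument of [herm] can be registered as
    a linear structure. *)
Definition hermr q p := herm p q.

HB.instance Definition _ q :=
  GRing.isLinear.Build C {poly C} C *%R (hermr q) (fun a p p' => herm_linearl a p p' q).

Lemma hermZl a p q : herm (a *: p) q = a * herm p q.
Proof. by rewrite -[LHS]/(hermr q _) linearZ. Qed.

Lemma hermZr a p q : herm p (a *: q) = a^* * herm p q.
Proof. by rewrite herm_conjC hermZl rmorphM [in RHS]herm_conjC. Qed.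

Lemma herm_suml (I : finType) (F : I -> {poly C}) q :
  herm (\sum_i F i) q = \sum_i herm (F i) q.
Proof. exact: (linear_sum (hermr q)). Qed.

Lemma herm_sumr (I : finType) p (F : I -> {poly C}) :
  herm p (\sum_i F i) = \sum_i herm p (F i).
Proof.
rewrite herm_conjC herm_suml rmorph_sum.
by apply: eq_bigr => i _; rewrite [RHS]herm_conjC.
Qed.

Lemma herm_Xn k l : herm 'X^k 'X^l = (k == l)%:R.
Proof.
rewrite /herm size_polyXn big_ord_recr big1 /= => [|i _]; last first.
  by rewrite coefXn (ltn_eqF (ltn_ord i)) mul0r.
by rewrite !coefXn eqxx add0r mul1r rmorph_nat.
Qed.

Lemma herm_ge0 p : 0 <= herm p p.
Proof. by apply: sumr_ge0 => k _; rewrite -normCK exprn_ge0. Qed.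

Lemma herm_eq0 p : (herm p p == 0) = (p == 0).
Proof.
apply/eqP/eqP => [p0|->]; last by rewrite /herm size_poly0 big_ord0.
apply/polyP => k; rewrite coef0; case: (ltnP k (size p)) => [kp|];
  last exact: nth_default.
have ge0 (i : 'I_(size p)) : true -> 0 <= p`_i * (p`_i)^* by rewrite -normCK exprn_ge0.
by have /eqP := psumr_eq0P ge0 p0 (i := Ordinal kp) isT;
  rewrite -normCK expf_eq0 normr_eq0 => /eqP.
Qed.

(** The linear map that sends the monomial ['X^k] to [u k]. *)
Definition lin_ext u p : {poly C} := \sum_(k < size p) p`_k *: u k.

Lemma lin_ext_widen n u p : (size p <= n)%N -> lin_ext u p = \sum_(k < n) p`_k *: u k.
Proof.
move=> pn; rewrite /lin_ext (big_ord_widen n (fun k => p`_k *: u k)) // big_mkcond.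
apply: eq_bigr => k _; case: ltnP => // pk; by rewrite nth_default ?scale0r.
Qed.

Lemma lin_extP u a p q : lin_ext u (a *: p + q) = a *: lin_ext u p + lin_ext u q.
Proof.
pose n := maxn (maxn (size p) (size q)) (size (a *: p + q)).
rewrite !(lin_ext_widen (n := n)) ?leq_max ?leqnn ?orbT // scaler_sumr -big_split.
by apply: eq_bigr => k _; rewrite coefD coefZ scalerDl scalerA.
Qed.

HB.instance Definition _ u :=
  GRing.isLinear.Build C {poly C} {poly C} *:%R (lin_ext u) (lin_extP u).

Lemma lin_ext_Xn u k : lin_ext u 'X^k = u k.
Proof.
rewrite /lin_ext size_polyXn big_ord_recr big1 /= => [|i _]; last first.
  by rewrite coefXn (ltn_eqF (ltn_ord i)) scale0r.
by rewrite !coefXn eqxx add0r scale1r.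
Qed.

Lemma lin_ext_comp u v p : lin_ext u (lin_ext v p) = lin_ext (lin_ext u \o v) p.
Proof. by rewrite {2}/lin_ext linear_sum; apply: eq_bigr => k _; rewrite linearZ. Qed.

Lemma eq_lin_ext u v : u =1 v -> lin_ext u =1 lin_ext v.
Proof. by move=> uv p; apply: eq_bigr => k _; rewrite uv. Qed.

(** The flag [b] treats together the isometries ([true]) and the pairs of maps with orthogonal
    images ([false]). *)
Lemma herm_lin_ext u v (b : bool) p q :
  (forall k l, herm (u k) (v l) = ((k == l) && b)%:R) ->
  herm (lin_ext u p) (lin_ext v q) = if b then herm p q else 0.
Proof.
move=> uv; pose n := maxn (size p) (size q).
have pn : (size p <= n)%N by rewrite leq_maxl.
have qn : (size q <= n)%N by rewrite leq_maxr.
rewrite (lin_ext_widen u pn) (lin_ext_widen v qn) (herm_widen q pn).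
rewrite herm_suml (eq_bigr (fun k : 'I_n => if b then p`_k * (q`_k)^* else 0)) => [|k _].
  by case: b uv => // _; rewrite big1.
rewrite herm_sumr (bigD1 k) //= big1 ?addr0 => [|l lk].
  by rewrite hermZl hermZr uv eqxx; case: b {uv}; rewrite ?mulr1 // !mulr0.
by rewrite hermZl hermZr uv eq_sym (negPf (lk : l != k :> nat)) !mulr0.
Qed.
End Hermitian.

(** * The real inner product space underlying the complex polynomials *)

Section ComplexReal.
Variable R : realType.
Implicit Types x y : R[i].

Lemma ReD x y : complex.Re (x + y) = complex.Re x + complex.Re y.
Proof. by case: x y => [? ?] [? ?]. Qed.

Lemma ReM (a : R) x : complex.Re (a%:C%C * x) = a * complex.Re x.
Proof. by case: x => [b c] /=; rewrite mul0r subr0. Qed.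

Lemma Re_conj x : complex.Re x^* = complex.Re x.
Proof. by case: x. Qed.

Lemma Re_sum (I : finType) (F : I -> R[i]) :
  complex.Re (\sum_i F i) = \sum_i complex.Re (F i).
Proof. by apply: (big_morph _ ReD). Qed.

Lemma Re_gt0 x : 0 < x -> 0 < complex.Re x.
Proof. by rewrite ltcE => /andP[]. Qed.
End ComplexReal.

(* Scalars are restricted to R, see [cpolyZE]; the alias keeps this structure
   apart from the canonical R[i]-module structure of {poly R[i]}. *)
Definition cpoly (R : realType) := {poly R[i]}.

Section RealStructure.
Variable R : realType.

HB.instance Definition _ := GRing.Zmodule.on (cpoly R).

Definition cpoly_scale (a : R) (p : cpoly R) : cpoly R := a%:C%C *: (p : {poly R[i]}).

Fact cpoly_scaleA a b p : cpoly_scale a (cpoly_scale b p) = cpoly_scale (a * b) p.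
Proof. by rewrite /cpoly_scale scalerA -rmorphM. Qed.
Fact cpoly_scale1 : left_id 1 cpoly_scale.
Proof. exact: scale1r. Qed.
Fact cpoly_scaleDr : right_distributive cpoly_scale +%R.
Proof. by move=> a p q; apply: scalerDr. Qed.
Fact cpoly_scaleDl p : {morph cpoly_scale^~ p : a b / a + b}.
Proof. by move=> a b; rewrite /cpoly_scale rmorphD /= scalerDl. Qed.

HB.instance Definition _ := GRing.Zmodule_isLmodule.Build R (cpoly R)
  cpoly_scaleA cpoly_scale1 cpoly_scaleDr cpoly_scaleDl.

Lemma cpolyZE (a : R) (p : cpoly R) : a *: p = a%:C%C *: (p : {poly R[i]}).
Proof. by []. Qed.

Definition cdot (p q : cpoly R) : R := complex.Re (herm p q).

Fact cdotC p q : cdot p q = cdot q p.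
Proof. by rewrite /cdot herm_conjC Re_conj. Qed.

Fact cdotP q a p p' : cdot (a *: p + p') q = a * cdot p q + cdot p' q.
Proof. by rewrite /cdot cpolyZE herm_linearl ReD ReM. Qed.

Fact cdot_bilinear :
  bilinear_for (GRing.Scale.Law.clone _ _ *%R _)
               (GRing.Scale.Law.clone _ _ (idfun \; *%R) _) cdot.
Proof.
split=> [q | p] a x y /=; first exact: cdotP.
by rewrite ![cdot p _]cdotC; apply: cdotP.
Qed.

HB.instance Definition _ :=
  bilinear_isBilinear.Build R _ _ _ _ _ cdot cdot_bilinear.

Fact cdot_sym : forall p q, cdot p q = (-1) ^+ false * idfun (cdot q p).
Proof. by move=> p q; rewrite mul1r; apply: cdotC. Qed.

HB.instance Definition _ :=
  isHermitianSesquilinear.Build R _ false idfun cdot cdot_sym.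

Fact cdot_gt0 : forall p, p != 0 -> 0 < cdot p p.
Proof. by move=> p p0; rewrite Re_gt0 // lt_neqAle herm_ge0 eq_sym herm_eq0 p0. Qed.

HB.instance Definition _ := isDotProduct.Build R _ cdot cdot_gt0.

Definition clin_ext (u : nat -> {poly R[i]}) (p : cpoly R) : cpoly R := lin_ext u p.

Fact clin_ext_linear u : linear (clin_ext u).
Proof. by move=> a p q; apply: lin_extP. Qed.

HB.instance Definition _ u :=
  GRing.isLinear.Build R (cpoly R) (cpoly R) *:%R (clin_ext u) (clin_ext_linear u).

Definition sum_ext n (u : 'I_n -> nat -> {poly R[i]}) (x : {ffun 'I_n -> cpoly R}) :
    cpoly R :=
  \sum_(i < n) clin_ext (u i) (x i).

Fact sum_ext_linear n (u : 'I_n -> nat -> {poly R[i]}) : linear (sum_ext u).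
Proof.
move=> a x y; rewrite /sum_ext scaler_sumr -big_split.
by apply: eq_bigr => i _; rewrite !ffunE linearP.
Qed.

HB.instance Definition _ n (u : 'I_n -> nat -> {poly R[i]}) :=
  GRing.isLinear.Build R {ffun 'I_n -> cpoly R} (cpoly R) *:%R
    (sum_ext u) (sum_ext_linear u).

Lemma cdot_sum_ext n (u : 'I_n -> nat -> {poly R[i]}) x y :
  (forall i j k l, herm (u i k) (u j l) = ((k == l) && (i == j))%:R) ->
  cdot (sum_ext u x) (sum_ext u y) = \sum_(i < n) cdot (x i) (y i).
Proof.
move=> uu; rewrite /cdot /sum_ext /clin_ext herm_suml Re_sum; apply: eq_bigr => i _.
rewrite herm_sumr (bigD1 i) //= (herm_lin_ext (b := true)) => [|k l];
  last by rewrite uu eqxx.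
rewrite big1 ?addr0 // => j ji; rewrite (herm_lin_ext (b := false)) // => k l.
by rewrite uu eq_sym [i == j]eq_sym (negPf ji).
Qed.

End RealStructure.

(** * Representations that are diagonal on monomials *)

Section DiagonalRep.
Variables (R : realType) (gT : finGroupType) (chi : nat -> gT -> R[i]).
Hypotheses (chi1 : forall k, chi k 1%g = 1)
  (chiM : forall k, {morph chi k : g h / (g * h)%g >-> g * h})
  (chi_unit : forall k g, chi k g * (chi k g)^* = 1).

Definition diag_act (g : gT) : {linear cpoly R -> cpoly R} :=
  clin_ext (fun k => chi k g *: 'X^k).

(** It suffices to look at monomials. For [v = u] this is equivariance; two distinct families occur
    when [g] also permutes the summands of a direct sum. *)
Lemma diag_act_lin_ext g (u v : nat -> {poly R[i]}) (p : cpoly R) :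
  (forall k, diag_act g (u k) = chi k g *: v k) ->
  diag_act g (lin_ext u p) = lin_ext v (diag_act g p).
Proof.
move=> uv; rewrite /= /clin_ext !lin_ext_comp; apply: eq_lin_ext => k /=.
by rewrite linearZ /= lin_ext_Xn -uv.
Qed.

Lemma diag_act_Xn g k : diag_act g 'X^k = chi k g *: 'X^k.
Proof. exact: lin_ext_Xn. Qed.

Lemma diag_act_ZXn g (a : R[i]) k :
  diag_act g (a *: 'X^k : {poly R[i]}) = (chi k g * a) *: 'X^k :> {poly R[i]}.
Proof. by rewrite /= /clin_ext linearZ /= lin_ext_Xn scalerA mulrC. Qed.

Lemma coef_diag_act g p k : (diag_act g p)`_k = chi k g * p`_k.
Proof.
rewrite /= /clin_ext (@lin_ext_widen _ (maxn k.+1 (size p))) ?leq_maxr // coef_sum.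
have lek : (k < maxn k.+1 (size p))%N by rewrite leq_max leqnn.
rewrite (bigD1 (Ordinal lek)) //= big1 ?addr0 => [|l lk].
  by rewrite !coefZ coefXn eqxx mulr1 mulrC.
rewrite !coefZ coefXn eq_sym.
by rewrite (negPf (lk : l != k :> nat)) !mulr0.
Qed.

Fact diag_act1 p : diag_act 1%g p = p.
Proof. by apply/polyP => k; rewrite coef_diag_act chi1 mul1r. Qed.

Fact diag_actM g h p : diag_act (g * h)%g p = diag_act g (diag_act h p).
Proof. by apply/polyP => k; rewrite !coef_diag_act chiM mulrA. Qed.

Fact diag_act_isom g : isometry (@cdot R) (@cdot R) (diag_act g).
Proof.
move=> p q; congr complex.Re; apply: (@herm_lin_ext _ _ _ true) => k l.
rewrite hermZl hermZr herm_Xn andbT; case: eqVneq => [->|_]; last by rewrite !mulr0.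
by rewrite mulr1 chi_unit.
Qed.

Definition diagRep : isomRep R gT := IsomRep diag_act1 diag_actM diag_act_isom.

End DiagonalRep.

(** * Universes from sets of frequencies *)

Section HamelBasis.
Variable R : realType.

Definition cpoly_basis (k : nat) : cpoly R :=
  (if odd k then 'i%C else 1) *: 'X^(k./2) : {poly R[i]}.

Definition cpoly_coord (k : nat) (p : cpoly R) : R :=
  let z := (p : {poly R[i]})`_(k./2) in if odd k then complex.Im z else complex.Re z.

Fact cpoly_coord_linear k : scalar (cpoly_coord k).
Proof.
move=> a p q; rewrite /cpoly_coord cpolyZE coefD coefZ.
move: (nth 0 (p : {poly R[i]}) _) (nth 0 (q : {poly R[i]}) _) => [b c] [b' c'].
by case: ifP => _ /=; ring.
Qed.

HB.instance Definition _ k :=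
  GRing.isLinear.Build R (cpoly R) R *%R (cpoly_coord k) (cpoly_coord_linear k).

Lemma cpoly_coord_basis k l : cpoly_coord k (cpoly_basis l) = (k == l)%:R.
Proof.
have -> : (k == l) = (odd k == odd l) && (k./2 == l./2) by lia.
rewrite /cpoly_coord /cpoly_basis coefZ coefXn.
by case: (odd k); case: (odd l); case: eqVneq => _ /=; ring.
Qed.

Lemma cpoly_coord_inj p q : (forall k, cpoly_coord k p = cpoly_coord k q) -> p = q.
Proof.
move=> pq; apply/polyP => k; apply/eqP; rewrite eq_complex.
have := pq k.*2; have := pq k.*2.+1.
rewrite /cpoly_coord /= odd_double /= uphalf_double doubleK.
by move=> -> ->; rewrite !eqxx.
Qed.
Lemma cpoly_basisP :
  (forall n (c : 'I_n -> R), \sum_(i < n) c i *: cpoly_basis i = 0 -> forall i, c i = 0)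
  /\ (forall p : cpoly R, exists n, exists c : 'I_n -> R,
        p = \sum_(i < n) c i *: cpoly_basis i).
Proof.
have coordE n (c : 'I_n -> R) k : cpoly_coord k (\sum_(i < n) c i *: cpoly_basis i) =
    \sum_(i < n) c i * (k == i)%:R.
  by rewrite linear_sum; apply: eq_bigr => i _; rewrite linearZ /= cpoly_coord_basis.
split=> [n c c0 i|p].
  have := coordE n c i; rewrite c0 linear0 (bigD1 i) //= eqxx mulr1 big1 ?addr0 // => l li.
  by rewrite eq_sym (negPf (li : l != i :> nat)) mulr0.
exists (size p).*2, (fun i => cpoly_coord i p).
apply: cpoly_coord_inj => k; rewrite coordE.
case: (ltnP k (size p).*2) => [kp|pk].
  rewrite (bigD1 (Ordinal kp)) //= eqxx mulr1 big1 ?addr0 // => l lk.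
  by rewrite eq_sym (negPf (lk : l != k :> nat)) mulr0.
rewrite big1 => [|l _]; first rewrite /cpoly_coord nth_default.
- by case: ifP.
- by rewrite geq_half_double.
by rewrite gtn_eqF ?mulr0 // (leq_trans (ltn_ord l)).
Qed.
End HamelBasis.

Section Universe.
Variables (R : realType) (gT : finGroupType) (w : gT -> R[i]) (I : int -> Prop).
Hypotheses (w1 : w 1%g = 1) (wM : {morph w : g h / (g * h)%g >-> g * h})
  (w_unit : forall g, w g * (w g)^* = 1) (I0 : I 0).

(* Each x in I is the frequency of infinitely many k, namely of all [slot a x]. *)
Definition freq (k : nat) : int :=
  if (unpickle k : option (nat * int)) is Some (_, x)
  then (if `[< I x >] then x else 0) else 0.

Definition slot (a : nat) (x : int) : nat := pickle (a, x).

(** Indices that code no pair with second entry in [I] fall back to the frequency 0, which is in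
    [I]. *)
Lemma freqP k : I (freq k).
Proof. by rewrite /freq; case: unpickle => [[_ x]|] //; case: asboolP. Qed.

Lemma freq_slot a x : I x -> freq (slot a x) = x.
Proof. by rewrite /freq pickleK => /asboolT ->. Qed.

Lemma slot_inj a b x y : slot a x = slot b y -> a = b.
Proof. by move/(pcan_inj pickleK) => []. Qed.

Definition chi k g : R[i] := w g ^ freq k.

Lemma w_neq0 g : w g != 0.
Proof.
apply/eqP => wg0; have := w_unit g; rewrite wg0 mul0r => /eqP.
by rewrite eq_sym oner_eq0.
Qed.

Lemma w_conj g : (w g)^* = (w g)^-1.
Proof. by apply: (mulfI (w_neq0 g)); rewrite w_unit mulfV ?w_neq0. Qed.

Fact chi1 k : chi k 1%g = 1.
Proof. by rewrite /chi w1 exp1rz. Qed.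

Fact chiM k : {morph chi k : g h / (g * h)%g >-> g * h}.
Proof. by move=> g h; rewrite /chi wM expfzMl. Qed.

Lemma w_exp_conj g (x : int) : (w g ^ x)^* = w g ^ (- x).
Proof. by rewrite rmorphXz ?unitfE ?w_neq0 //= w_conj exprz_inv. Qed.

Fact chi_unit k g : chi k g * (chi k g)^* = 1.
Proof. by rewrite w_exp_conj -expfzDr ?w_neq0 // subrr expr0z. Qed.

Definition freqRep := diagRep chi1 chiM chi_unit.

Lemma freqRep_universe : universe freqRep.
Proof.
split; first by exists (@cpoly_basis R); apply: cpoly_basisP.
  (* The whole space embeds infinitely often, and [W] with it: the [l]-th copy moves ['X^k] to a
     slot of the same frequency, and different [(l, k)] get different slots. *)
  move=> W _; pose u (l k : nat) : {poly R[i]} := 'X^(slot (pickle (l, k)) (freq k)).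
  have u_inj (l l' k k' : nat) :
      slot (pickle (l, k)) (freq k) = slot (pickle (l', k')) (freq k') -> (l, k) = (l', k').
    by move/slot_inj/(pcan_inj pickleK).
  exists (fun l (p : cpoly R) => clin_ext (u l) p).
  split=> [l a x y _ _|l g x _|l l' x y _ _].
  - exact: linearP.
  - apply/esym/diag_act_lin_ext => k.
    by rewrite diag_act_Xn /chi freq_slot //; apply: freqP.
  rewrite /= /cdot (herm_lin_ext (b := l == l')); first by case: eqP.
  move=> k k'; rewrite herm_Xn; congr (nat_of_bool _)%:R.
  by apply/eqP/andP => [/u_inj[-> ->]|[/eqP-> /eqP->]].
exists ('X^(slot 0 0) : cpoly R); first by rewrite monic_neq0 ?monicXn.
by move=> g; rewrite /Defs.act /= diag_act_Xn /chi freq_slot // expr0z scale1r.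
Qed.
End Universe.

(** * The associated transfer system *)

Section AssociatedTransfer.
Variables (R : realType) (gT : finGroupType) (w : gT -> R[i]) (I : int -> Prop).
Hypotheses (w1 : w 1%g = 1) (wM : {morph w : g h / (g * h)%g >-> g * h})
  (w_unit : forall g, w g * (w g)^* = 1) (I0 : I 0).
Hypotheses (w_faithful : forall g, w g = 1 -> g = 1%g) (cycG : cyclic [set: gT]).
Variables K H : {group gT}.
Hypothesis KH : K \subset H.

Let U := freqRep I w1 wM w_unit.
Let r := #|H : K|%g.
Let w0 := w_neq0 w_unit.

Definition coset_rep (i : 'I_#|H : K|%g) : gT := repr (coset_at i).
Let t_ := coset_rep.

Lemma coset_repP i : t_ i \in H /\ coset_at i = (t_ i *: K)%g.
Proof.
have : coset_at i \in lcosets K H by apply/coset_atP; exists i.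
rewrite /t_ /coset_rep => /lcosetsP[x xH ->].
have /lcosetP[k kK ->] := mem_repr _ (lcoset_refl K x).
split; first by rewrite groupM // (subsetP KH).
by apply/lcoset_eqP; rewrite mem_lcoset invMg mulgKV groupV.
Qed.

Lemma w_expn g n : w (g ^+ n)%g = w g ^+ n.
Proof. by elim: n => [|n IHn]; rewrite ?w1 // expgS exprS wM IHn. Qed.

Lemma wV g : w g^-1%g = (w g)^-1.
Proof. by apply: (mulfI (w0 g)); rewrite -wM mulgV w1 mulfV. Qed.

Lemma w_exp_card (N : {group gT}) g (x y : int) : g \in N -> (#|N| %| x - y)%Z ->
  w g ^ x = w g ^ y.
Proof.
move=> gN /dvdzP[z xy]; rewrite -[x](subrK y) xy [z * _]mulrC expfzDr // -exprz_exp.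
by rewrite -exprnP -w_expn expg_cardG // w1 exp1rz mul1r.
Qed.

(** On [K] the values of [w] are [#|K|]-th roots of unity, so [w _ ^+ #|K|] is constant on cosets of
    [K]. *)
Lemma w_coset i g h : g \in H -> (g *: coset_at i = coset_at h)%g ->
  w (t_ h) ^+ #|K| = w g ^+ #|K| * w (t_ i) ^+ #|K|.
Proof.
have [_ ->] := coset_repP i; have [_ ->] := coset_repP h.
move=> gH; rewrite -lcosetM => E.
have : (t_ h \in (g * t_ i) *: K)%g by rewrite E lcoset_refl.
case/lcosetP=> k kK ->; rewrite !wM !exprMn -[w k ^+ _]w_expn expg_cardG // w1 mulr1.
by [].
Qed.

(** Equal powers give a quotient of representatives whose order divides [#|K|]; in a cyclic group it
    lies in [K]. *)
Lemma w_coset_inj i j : w (t_ i) ^+ #|K| = w (t_ j) ^+ #|K| -> i = j.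
Proof.
move=> wij; apply: (@coset_at_inj _ K H).
have [_ ->] := coset_repP i; have [_ ->] := coset_repP j.
suff tK : ((t_ j)^-1 * t_ i)%g \in K by apply/lcoset_eqP; rewrite mem_lcoset.
have o_dvd : (#[(t_ j)^-1 * t_ i]%g %| #|K|)%N.
  rewrite order_dvdn; apply/eqP/w_faithful.
  by rewrite w_expn wM wV exprMn wij exprVn mulVf ?expf_neq0.
by rewrite -cycle_subG (cyclic_subG cycG) -orderE.
Qed.

(* Fourier analysis on H/K: the t-th Fourier coefficient of the k-th coordinates
   lies over the restriction to H of w^(freq k + t|K|), which some element f (k, t)
   of I induces as well. *)
Lemma full_preimage_assoc : full_preimage I #|K| #|H| -> assoc_transfer U K H.
Proof.
move=> sat; split=> //.
have /choice[f fP] (kt : nat * nat) : exists y, I y /\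
    (#|H| %| y - (freq I kt.1 + kt.2%:Z * #|K|%:Z))%Z.
  by have [y] := sat _ kt.2 (freqP I0 kt.1); exists y.
pose s : R[i] := sqrtC (r%:R)^-1.
have sP : s * s^* = (r%:R)^-1.
  by rewrite geC0_conj ?sqrtC_ge0 ?invr_ge0 // -expr2 sqrtCK.
(* These are [r] distinct [r]-th roots of unity, which [h] in [H] permutes through multiplication by
   [w h ^+ #|K|]. *)
pose z i := w (t_ i) ^+ #|K|.
pose sl k (t : 'I_r) := slot (pickle (k, t : nat)) (f (k, t : nat)).
(* The [i]-th copy of ['X^k] goes to a row of the discrete Fourier matrix, normalized by [s] and
   spread over the distinct slots [sl k t]. *)
pose u i k : {poly R[i]} := \sum_(t < r) (s * z i ^+ t) *: 'X^(sl k t).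
have chi_sl g k t : g \in H -> chi w I (sl k t) g = chi w I k g * (w g ^+ #|K|) ^+ t.
  move=> gH; rewrite /chi freq_slot; last by case: (fP (k, t : nat)).
  rewrite (w_exp_card gH (fP (k, t : nat)).2) expfzDr //=; congr (_ * _).
  by rewrite -exprM mulnC -PoszM.
have sl_inj k l t t' : (sl k t == sl l t') = (k == l) && (t == t').
  by apply/eqP/andP => [/slot_inj/(pcan_inj pickleK)[-> /val_inj->]|[/eqP-> /eqP->]].
have u_orth i j k l : herm (u i k) (u j l) = ((k == l) && (i == j))%:R.
  rewrite herm_suml.
  transitivity (\sum_(t < r) (k == l)%:R / r%:R * (z i * (z j)^*) ^+ t).
    apply: eq_bigr => t _; rewrite herm_sumr (bigD1 t) //= big1 ?addr0 => [|t' t't].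
      rewrite hermZl hermZr herm_Xn sl_inj eqxx andbT rmorphM rmorphXn exprMn -sP /=.
      ring.
    by rewrite hermZl hermZr herm_Xn sl_inj [t == t']eq_sym (negPf t't) andbF !mulr0.
  rewrite -mulr_sumr; case: eqVneq => [_|_]; last by rewrite !mul0r.
  have r0 : r%:R != 0 :> R[i] by rewrite pnatr_eq0 -lt0n indexg_gt0.
  case: eqVneq => [->|ij] /=.
    have -> : z j * (z j)^* = 1 by rewrite rmorphXn /= -exprMn w_unit expr1n.
    under eq_bigr do rewrite expr1n.
    by rewrite sumr_const card_ord mul1r mulVf.
  have zz : z j * (z j)^* = 1 by rewrite rmorphXn /= -exprMn w_unit expr1n.
  have zr e : z e ^+ r = 1.
    by rewrite -exprM Lagrange // -w_expn expg_cardG ?w1 //; case: (coset_repP e).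
  (* A geometric sum over the powers of an [r]-th root of unity other than 1 vanishes. *)
  have : (z i * (z j)^* - 1) * (\sum_(t < r) (z i * (z j)^*) ^+ t) = 0.
    by rewrite -subrX1 exprMn -rmorphXn !zr rmorph1 mulr1 subrr.
  move/eqP; rewrite mulf_eq0 subr_eq0 => /orP[/eqP zij1|/eqP->]; last by rewrite mulr0.
  case/eqP: ij; apply: w_coset_inj; rewrite -/(z i) -/(z j).
  by rewrite -[z i]mulr1 -zz mulrCA zij1 mulr1.
have F_isom : isometry (dot U) (@dsum_dot R gT U r) (sum_ext u).
  by move=> x y; apply: cdot_sum_ext.
exists (LinIsom F_isom) => -[h sigma] /=; rewrite inE /= => /andP[hH /forallP sigmaP] x.
rewrite /linIsom_act_fun /= /sum_ext linear_sum [RHS](reindex_inj (@perm_inj _ sigma)).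
apply: eq_bigr => i _; rewrite ffunE.
transitivity (clin_ext (u (sigma i))
  (@Defs.act _ _ U h (@Defs.act _ _ U h^-1%g (x (sigma i))))).
  apply: diag_act_lin_ext => k; rewrite /u scaler_sumr.
  transitivity (\sum_(t < r)
    diag_act (chi w I) h ((s * z i ^+ t) *: 'X^(sl k t) : {poly R[i]})).
    exact: linear_sum.
  apply: eq_bigr => t _; rewrite diag_act_ZXn chi_sl // scalerA.
  have -> : z (sigma i) = w h ^+ #|K| * z i by apply: w_coset hH (eqP (sigmaP i)).
  by rewrite exprMn; congr (_ *: 'X^_); ring.
by rewrite -Defs.actM mulgV Defs.act1.
Qed.

Lemma w_exp_order g (x y : int) : w g ^ x = w g ^ y -> (#[g]%g %| x - y)%Z.
Proof.
move=> wxy; have : w g ^ (x - y) = 1 by rewrite expfzDr // wxy -expfzDr // subrr expr0z.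
suff w_abs (z : int) : w g ^ z = 1 -> (#[g]%g %| `|z|)%N by move/w_abs.
move=> wz; rewrite order_dvdn; apply/eqP/w_faithful; rewrite w_expn.
case: z wz => [n|n] /=; first by rewrite -exprnP.
by rewrite NegzE -exprz_inv -exprnP exprVn -[X in _ = X]invr1 => /invr_inj.
Qed.

(** The direct sum contains a real plane that [H] rotates through the character
    [w ^ (x + t * #|K|)]. As [f] is injective and equivariant, this character or its conjugate
    occurs in [U] over [H]; the symmetry of [I] handles the conjugate. *)
Lemma assoc_full_preimage : (forall x, I x -> I (- x)) ->
  assoc_transfer U K H -> full_preimage I #|K| #|H|.
Proof.
move=> IN [_ [f f_fix]] x t Ix.
(* Permuting cosets by [h] multiplies [lam] by [(w h ^+ #|K|) ^ (- t)]; this produces the second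
   factor of [psi]. *)
pose k0 := slot 0 x; pose lam i := (w (t_ i) ^+ #|K|) ^ (- t).
pose psi g := w g ^ x * (w g ^+ #|K|) ^ t.
pose X a : {ffun 'I_r -> U} := [ffun i => (a * lam i) *: 'X^k0 : {poly R[i]}].
have actX h a : h \in H -> Defs.act h (f (X a)) = f (X (psi h * a)).
  move=> hH; have [sigma [hs _]] := Gamma_graph K hH.
  rewrite -[RHS](f_fix _ hs) /= /linIsom_act_fun; congr (Defs.act h (f _)).
  apply/ffunP => i; rewrite !ffunE /Defs.act /= diag_act_ZXn /chi freq_slot // wV.
  move: hs; rewrite inE /= => /andP[_ /forallP/(_ i)/eqP/(w_coset hH) wE].
  rewrite /lam -/t_ wE -!invr_expz expfzMl exprz_inv -invr_expz /psi.
  congr (_ *: 'X^_). by field; rewrite !expfz_neq0 ?expf_neq0.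
have decX a : f (X a) = complex.Re a *: f (X 1) + complex.Im a *: f (X 'i%C).
  transitivity (f (complex.Re a *: X 1 + complex.Im a *: X 'i%C));
    last by rewrite linearD !linearZ.
  congr (f _); apply/ffunP => i; rewrite !ffunE.
  by apply/polyP => l; rewrite coefD !coefZ {1}[a]complexE; ring.
pose y := f (X 1); pose y' := f (X 'i%C).
have [k yk] : exists k, (y : {poly R[i]})`_k != 0.
  apply: contrapT => y_coef0.
  have y0 : y = 0.
    apply/polyP => k; rewrite coef0; apply/eqP/negPn/negP => yk.
    by apply: y_coef0; exists k.
  have : X 1 != 0.
    apply/eqP => /ffunP/(_ (Ordinal (indexg_gt0 H K))).
    rewrite !ffunE => /polyP/(_ k0)/eqP.
    rewrite coefZ coefXn eqxx coef0 mulr1 mul1r.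
    by rewrite expfz_eq0 expf_eq0 (negPf (w0 _)) !andbF.
  move/(@neq0_dnorm_gt0 _ _ idfun (@dsum_dot R gT U r)).
  by rewrite -(lin_funP f) -/y y0 linear0l ltxx.
have coefX h a : h \in H -> chi w I k h * (f (X a) : {poly R[i]})`_k =
    (complex.Re (psi h * a))%:C%C * y`_k + (complex.Im (psi h * a))%:C%C * y'`_k.
  move=> hH; transitivity (Defs.act h (f (X a)) : {poly R[i]})`_k.
    exact/esym/coef_diag_act.
  by rewrite actX // decX coefD !coefZ /y /y'.
have i2 : 'i%C * 'i%C = -1 :> R[i] by rewrite -expr2 sqr_i.
(* f is only real linear: on the real plane spanned by X 1 and X 'i, H acts by the
   rotation psi, and the k-th coordinate intertwines it with chi k.  The two
   combinations below are its complex linear and conjugate linear parts, so that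
   chi k is psi or its conjugate on H. *)
have coefu h : h \in H ->
    chi w I k h * (y`_k - 'i%C * y'`_k) = psi h * (y`_k - 'i%C * y'`_k).
  move=> hH; rewrite mulrBr mulrCA /y /y' !coefX // -/y -/y' mulr1 ReiNIm ImiRe rmorphN /=.
  by rewrite [psi h in RHS]complexE; ring: i2.
have coefv h : h \in H ->
    chi w I k h * (y`_k + 'i%C * y'`_k) = (psi h)^* * (y`_k + 'i%C * y'`_k).
  move=> hH; rewrite mulrDr mulrCA /y /y' !coefX // -/y -/y' mulr1 ReiNIm ImiRe rmorphN /=.
  have -> : (psi h)^* = (complex.Re (psi h))%:C%C - 'i%C * (complex.Im (psi h))%:C%C.
    apply/eqP; rewrite eq_complex; case: (psi h) => ? ? /=.
    by apply/andP; split; apply/eqP; ring.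
  by ring: i2.
(* Congruence modulo [#|H|] can be read off from the values of the characters at a generator of
   [H]. *)
have [h hgen] := cyclicP (cyclicS (subsetT H) cycG).
have hH : h \in H by rewrite hgen cycle_id.
have oh : #|H| = #[h]%g by rewrite orderE -hgen.
have psiE : psi h = w h ^ (x + t * #|K|).
  by rewrite /psi expfzDr // [t * _]mulrC -exprz_exp.
have [u0|u0] := eqVneq (y`_k - 'i%C * y'`_k) 0; last first.
  exists (freq I k); first exact: freqP.
  by rewrite oh; apply: w_exp_order; rewrite -psiE; apply: (mulIf u0); apply: coefu.
(* The two combinations add up to twice the nonzero coefficient of [y], so they cannot both
   vanish. *)
have v0 : y`_k + 'i%C * y'`_k != 0.
  apply: contra_neq yk => v0.
  have : y`_k *+ 2 = y`_k - 'i%C * y'`_k + (y`_k + 'i%C * y'`_k) by ring.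
  by rewrite u0 v0 addr0 => /eqP; rewrite mulrn_eq0 => /eqP.
exists (- freq I k); first by apply: IN; apply: freqP.
rewrite -opprD rpredN oh -[X in _ + X]opprK; apply: w_exp_order.
rewrite -w_exp_conj // -psiE; by apply: (mulIf v0); apply: coefv.
Qed.

End AssociatedTransfer.

(** * A faithful character of a cyclic group *)

Lemma prim_root_exists (C : numClosedFieldType) n : (0 < n)%N ->
  exists z : C, n.-primitive_root z.
Proof.
move=> n_gt0; pose P : {poly C} := 'X^n - 1; have [s Ps] := closed_field_poly_normal P.
rewrite (monicP _) ?monicXnsubC // scale1r in Ps.
have s1 : all n.-unity_root s by apply/allP => z; rewrite -root_prod_XsubC -Ps.
have sz_s : (n < (size s).+1)%N by rewrite -(size_prod_XsubC s id) -Ps size_XnsubC.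
have [|z _] := hasP (has_prim_root n_gt0 s1 _ sz_s); last by exists z.
by rewrite -separable_prod_XsubC -Ps separable_Xn_sub_1 // pnatr_eq0 -lt0n.
Qed.

Lemma faithful_character (C : numClosedFieldType) (gT : finGroupType) :
  cyclic [set: gT] -> exists w : gT -> C,
    [/\ w 1%g = 1, {morph w : g h / (g * h)%g >-> g * h},
        forall g, w g * (w g)^* = 1 & forall g, w g = 1 -> g = 1%g].
Proof.
move=> /cyclicP[g0 gT_g0]; have [z z_prim] := prim_root_exists C (order_gt0 g0).
have /choice[e eP] g : exists k, g = (g0 ^+ k)%g by apply/cycleP; rewrite -gT_g0.
(* One direction makes [z ^+ e g] independent of the chosen exponent, hence multiplicative; the
   other gives faithfulness. *)
have zE k l : (z ^+ k == z ^+ l) = (g0 ^+ k == g0 ^+ l)%g.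
  by rewrite (eq_prim_root_expr z_prim) eq_expg_mod_order.
exists (fun g => z ^+ e g); split=> [|g h|g|g].
- by apply/eqP; rewrite -(expr0 z) zE -eP.
- by rewrite -exprD; apply/eqP; rewrite zE expgD -!eP.
- have z1 : `|z| = 1.
    by apply/eqP; rewrite -(pexpr_eq1 (order_gt0 g0)) // -normrX prim_expr_order ?normr1.
  by rewrite -normCK normrX z1 !expr1n.
by move/eqP; rewrite -(expr0 z) zE -eP => /eqP.
Qed.

Theorem theorem4p1 (R : realType) (p q n m : nat) (gT : finGroupType)
    (T : {group gT} -> {group gT} -> Prop) :
  prime p -> prime q -> p != q -> (5 <= p)%N -> (5 <= q)%N ->
  cyclic [set: gT] -> #|[set: gT]| = (p ^ n * q ^ m)%N ->
  transfer_system T -> saturated T ->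
  exists U : isomRep R gT,
    universe U /\ forall K H : {group gT}, assoc_transfer U K H <-> T K H.
Proof.
move=> p_pr q_pr neq_pq p_ge5 q_ge5 cycG; rewrite cardsT => oG trT satT.
have [I [I0 IN IT]] := saturated_realize p_pr q_pr neq_pq p_ge5 q_ge5 cycG oG trT satT.
have [w [w1 wM w_unit w_faithful]] := faithful_character R[i] cycG.
exists (freqRep I w1 wM w_unit); split; first exact: freqRep_universe.
move=> K H; split=> [asKH|TKH].
  have KH := asKH.1; apply/(IT _ _ KH).
  exact: assoc_full_preimage asKH.
have KH : K \subset H by case: trT => + _ _ _ _; apply.
by apply: full_preimage_assoc => //; apply/IT.
Qed.
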